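(* For $i\in\mathbb{N}$ let $a_i=(1,2,1,2,\dots)$ be the alternating surjection with $i+2$ entries, and let $A_i\colon N(\Delta^n)\to N(\Delta^n)^{\otimes 2}$ be its action on simplicial chains. Then $A_i=\triangle^{\mathrm S}_i$ for every $i\in\mathbb{N}$; that is, the alternating surjections define Steenrod's cup-$i$ construction.
   Context: All chains are over $\mathbb{F}_2$. $N(\Delta^n)$ has basis the faces $[v_0,\dots,v_m]$, $v_0<\dots<v_m$, of the standard $n$-simplex; $[n]$ is its top-dimensional face. **Diagonal and join.** The Alexander–Whitney diagonal $\triangle_{\mathrm{AW}}\colon N(\Delta^n)\to N(\Delta^n)^{\otimes2}$ is $\triangle_{\mathrm{AW}}[v_0,\dots,v_m]=\sum_{j=0}^m[v_0,\dots,v_j]\otimes[v_j,\dots,v_m]$. The join $\ast\colon N(\Delta^n)^{\otimes 2}\to N(\Delta^n)$ (degree $1$) sends a tensor of two faces to the face spanned by the union of their vertex sets if these are disjoint, and to $0$ otherwise. Set $\triangle_{\mathrm{AW}}^{[1]}=\mathrm{id}$, $\triangle_{\mathrm{AW}}^{[m+1]}=(\triangle_{\mathrm{AW}}^{[m]}\otimes\mathrm{id})\circ\triangle_{\mathrm{AW}}$, $\ast^{[1]}=\mathrm{id}$, $\ast^{[m+1]}=\ast\circ(\ast^{[m]}\otimes\mathrm{id})$. **Action of surjections.** A surjection $s\colon\{1,\dots,\ell\}\to\{1,\dots,r\}$ is represented by the sequence $(s(1),\dots,s(\ell))$. It is nondegenerate if $s(j)\neq s(j+1)$ for all $j$. The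 nondegenerate surjections onto $\{1,\dots,r\}$ form the basis of the arity $r$ part of the surjection operad, with $s$ in degree $\ell-r$. The action of $s$ on simplicial chains is the map $$\big(\ast^{[|s^{-1}(1)|]}\otimes\dots\otimes\ast^{[|s^{-1}(r)|]}\big)\circ\pi_s\circ\triangle_{\mathrm{AW}}^{[\ell]}\colon N(\Delta^n)\to N(\Delta^n)^{\otimes r},$$ where $\pi_s$ permutes the tensor factors so as to group them according to the fibers of $s$, preserving their order within each fiber. **Steenrod's construction.** $\triangle^{\mathrm S}_i\colon N(\Delta^n)\to N(\Delta^n)^{\otimes2}$ is the family of maps, natural with respect to coface maps, determined by the following values on top-dimensional faces. If $i>n$ then $\triangle^{\mathrm S}_i[n]=0$; otherwise $\triangle_i^{\mathrm S}[n]$ is the sum over all integers $0\le p_1<\dots<p_{i+1}\le n$ of $$[0,\dots,p_1]\ast[p_2,\dots,p_3]\ast\dots\ast[p_{i+1},\dots,n]\ \otimes\ [p_1,\dots,p_2]\ast\dots\ast[p_i,\dots,p_{i+1}]$$ if $i$ is odd, and of $$[0,\dots,p_1]\ast[p_2,\dots,p_3]\ast\dots\ast[p_i,\dots,p_{i+1}]\ \otimes\ [p_1,\dots,p_2]\ast[p_3,\dots,p_4]\ast\dots\ast[p_{i+1},\dots,n]$$ if $i$ is even, where $[a,\dots,b]$ denotes the face on all integers from $a$ to $b$. *)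

(* Defs.v *)
From HB Require Import structures.
From mathcomp Require Import all_boot all_order all_algebra.
From mathcomp Require Import zify.
Set Implicit Arguments.
Unset Strict Implicit.
Unset Printing Implicit Defensive.
Import GRing.Theory.
Local Open Scope ring_scope.

(* The F_2-vector space with basis T.  Tensor products of such spaces are
   represented on the product basis: chain A (x) chain B is chain (A * B), and
   (chain A)^{(x) m} is chain (m.-tuple A). *)
Definition chain (T : finType) : vectType 'F_2 := {ffun T -> ('F_2)^o}.

Definition delta (T : finType) (x : T) : chain T := [ffun y => (y == x)%:R].

Definition lext_fun (A B : finType) (f : A -> chain B) (u : chain A) : chain B :=
  \sum_a (u : {ffun A -> ('F_2)^o}) a *: f a.

Fact lext_is_linear (A B : finType) (f : A -> chain B) : linear (lext_fun f).
Proof.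
move=> k u v; rewrite /lext_fun scaler_sumr -big_split /=.
by apply: eq_bigr => a _; rewrite !ffunE scalerDl scalerA.
Qed.
HB.instance Definition _ (A B : finType) (f : A -> chain B) :=
  GRing.isLinear.Build 'F_2 (chain A) (chain B) _ (lext_fun f)
    (lext_is_linear f).

(* The linear map with prescribed values on the basis. *)
Definition lext (A B : finType) (f : A -> chain B) : 'Hom(chain A, chain B) :=
  linfun (lext_fun f).

Lemma lextE (A B : finType) (f : A -> chain B) (a : A) :
  lext f (delta a) = f a.
Proof.
rewrite lfunE /= /lext_fun (bigD1 a) //= ffunE eqxx scale1r big1 ?addr0 //.
by move=> b /negPf ba; rewrite ffunE ba scale0r.
Qed.

Lemma chain_sum (A : finType) (u : chain A) :
  u = \sum_a (u : {ffun A -> ('F_2)^o}) a *: delta a.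
Proof.
apply/ffunP => b; rewrite sum_ffunE (bigD1 b) //= !ffunE eqxx.
rewrite big1 ?addr0 => [|c /negPf cb]; last by rewrite !ffunE eq_sym cb scaler0.
by rewrite /GRing.scale /= mulr1.
Qed.

Lemma hom_ext (A B : finType) (f g : 'Hom(chain A, chain B)) :
  (forall a, f (delta a) = g (delta a)) -> f = g.
Proof.
move=> fg; apply/lfunP => u; rewrite (chain_sum u) !linear_sum.
by apply: eq_bigr => a _; rewrite !linearZZ; congr (_ *: _); apply: fg.
Qed.

Definition bmap (A B : finType) (f : A -> B) : 'Hom(chain A, chain B) :=
  lext (fun a => delta (f a)).

Definition tens (A B : finType) (u : chain A) (v : chain B) : chain (A * B)%type :=
  [ffun ab => (u : {ffun A -> ('F_2)^o}) ab.1 * (v : {ffun B -> ('F_2)^o}) ab.2].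

Definition tens_hom (A B C D : finType)
    (f : 'Hom(chain A, chain C)) (g : 'Hom(chain B, chain D)) :
    'Hom(chain (A * B)%type, chain (C * D)%type) :=
  lext (fun ab => tens (f (delta ab.1)) (g (delta ab.2))).

(* f_1 (x) ... (x) f_r, for maps f_k whose sources may differ. *)
Definition bigtens_hom (r : nat) (A : 'I_r -> finType) (B : finType)
    (f : forall k, 'Hom(chain (A k), chain B)) :
    'Hom(chain {dffun forall k, A k}, chain (r.-tuple B)) :=
  lext (fun x : {dffun forall k, A k} =>
    [ffun y : r.-tuple B =>
       \prod_(k < r) (f k (delta (x k)) : {ffun B -> ('F_2)^o}) (tnth y k)]).

(* A face is identified with its nonempty set of vertices. *)
Definition face (n : nat) : finType := {F : {set 'I_n.+1} | F != set0}.
Definition NDelta (n : nat) : vectType 'F_2 := chain (face n).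

(* The face spanned by F; the value 0 on the empty set is a default. *)
Definition simplex (n : nat) (F : {set 'I_n.+1}) : NDelta n :=
  if insub F is Some G then delta (G : face n) else 0.

Definition AW (n : nat) : 'Hom(NDelta n, chain (face n * face n)%type) :=
  lext (fun F : face n =>
    \sum_(v in val F) tens (simplex [set x in val F | (x <= v)%N])
                           (simplex [set x in val F | (v <= x)%N])).

Definition join (n : nat) : 'Hom(chain (face n * face n)%type, NDelta n) :=
  lext (fun FG : face n * face n =>
    if [disjoint val FG.1 & val FG.2] then simplex (val FG.1 :|: val FG.2)
    else 0).

(* The identification N^{(x) m+1} = N^{(x) m} (x) N on basis elements. *)
Definition rcons_pair (T : Type) (m : nat) (tx : m.-tuple T * T) :
    m.+1.-tuple T := [tuple of rcons tx.1 tx.2].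
Definition unrcons (T : Type) (m : nat) (t : m.+1.-tuple T) : m.-tuple T * T :=
  (belast_tuple (thead t) (behead_tuple t), tnth t ord_max).

(* AW_iterS n m and join_iterS n m are the iterates with exponent m + 1. *)
Fixpoint AW_iterS (n m : nat) : 'Hom(NDelta n, chain (m.+1.-tuple (face n))) :=
  match m with
  | 0 => bmap (fun F : face n => [tuple F])
  | m'.+1 => (bmap (@rcons_pair (face n) m'.+1)
              \o tens_hom (AW_iterS n m') \1 \o AW n)%VF
  end.

Fixpoint join_iterS (n m : nat) : 'Hom(chain (m.+1.-tuple (face n)), NDelta n) :=
  match m with
  | 0 => bmap (fun t : 1.-tuple (face n) => thead t)
  | m'.+1 => (join n \o tens_hom (join_iterS n m') \1
              \o bmap (@unrcons (face n) m'.+1))%VF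
  end.

(* Exponent 0 does not occur for surjections; 0 is a default value. *)
Definition AW_iter (n m : nat) : 'Hom(NDelta n, chain (m.-tuple (face n))) :=
  if m is m'.+1 then AW_iterS n m' else 0.

Definition join_iter (n m : nat) : 'Hom(chain (m.-tuple (face n)), NDelta n) :=
  if m is m'.+1 then join_iterS n m' else 0.

(* Nondegenerate surjections {1..l} -> {1..r}, as sequences of values; indices
   and values are shifted to start at 0. *)
Record surjection (l r : nat) := Surjection {
  surj_seq :> l.-tuple 'I_r;
  surj_onto : forall k : 'I_r, k \in surj_seq;
  surj_nondeg : sorted (fun a b : 'I_r => a != b) surj_seq
}.

Definition fiber (l r : nat) (s : surjection l r) (k : 'I_r) : {set 'I_l} :=
  [set j | tnth s j == k].

(* The target of pi_s is the tensor product over k of the N^{(x) |s^-1(k)|};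
   enum_val lists the elements of a fiber in increasing order. *)
Definition fiber_perm (n l r : nat) (s : surjection l r) :
    'Hom(chain (l.-tuple (face n)),
         chain {dffun forall k : 'I_r, #|fiber s k|.-tuple (face n)}) :=
  bmap (fun x : l.-tuple (face n) =>
    [ffun k : 'I_r => [tuple tnth x (enum_val j) | j < #|fiber s k|]]
      : {dffun forall k : 'I_r, #|fiber s k|.-tuple (face n)}).

Definition surj_act (n l r : nat) (s : surjection l r) :
    'Hom(NDelta n, chain (r.-tuple (face n))) :=
  (bigtens_hom (fun k : 'I_r => join_iter n #|fiber s k|)
   \o fiber_perm n s \o AW_iter n l)%VF.

Definition alt_seq (i : nat) : i.+2.-tuple 'I_2 :=
  [tuple if odd j then ord_max else ord0 | j < i.+2].

Fact alt_onto (i : nat) (k : 'I_2) : k \in alt_seq i.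
Proof.
apply/tnthP; have k2 : (k < i.+2)%N by apply: leq_trans (ltn_ord k) _.
exists (Ordinal k2); rewrite tnth_mktuple /=; apply: val_inj => /=.
by case: k {k2} => [[|[|]]].
Qed.

Fact alt_nondeg (i : nat) : sorted (fun a b : 'I_2 => a != b) (alt_seq i).
Proof.
apply/(sortedP ord0) => j; rewrite size_tuple => ji.
have ji' := ltnW ji.
rewrite (_ : j = Ordinal ji') // (_ : (Ordinal ji').+1 = Ordinal ji) //.
by rewrite -!tnth_nth !tnth_mktuple /=; case: (odd j).
Qed.

Definition alternating (i : nat) : surjection i.+2 2 :=
  Surjection (@alt_onto i) (@alt_nondeg i).

(* The last factor identifies N^{(x) 2}, as 2-tuples, with N (x) N. *)
Definition alt_act (i n : nat) : 'Hom(NDelta n, chain (face n * face n)%type) :=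
  (bmap (fun t : 2.-tuple (face n) => (tnth t ord0, tnth t ord_max))
   \o surj_act n (alternating i))%VF.

Definition interval (n a b : nat) : NDelta n :=
  simplex [set x : 'I_n.+1 | (a <= x <= b)%N].

Definition joins (n : nat) (us : seq (NDelta n)) : NDelta n :=
  if us is u :: us' then foldl (fun x y => join n (tens x y)) u us' else 0.

(* With p_0 = 0 and p_{i+2} = n, the left factor joins the [p_k,...,p_{k+1}]
   with k even and the right factor those with k odd, 0 <= k <= i+1; the last
   interval [p_{i+1},...,n] is on the left iff i is odd. *)
Definition steenrod_top (i n : nat) : chain (face n * face n)%type :=
  if (n < i)%N then 0 else
  \sum_(p : i.+1.-tuple 'I_n.+1 | sorted ltn [seq val x | x <- p])
    let q := 0%N :: rcons [seq val x | x <- p] n in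
    let I k := interval n (nth 0%N q k) (nth 0%N q k.+1) in
    tens (joins [seq I k | k <- iota 0 i.+2 & ~~ odd k])
         (joins [seq I k | k <- iota 0 i.+2 & odd k]).

(* The chain map induced by an injective map of vertices. *)
Definition push (m n : nat) (phi : 'I_m.+1 -> 'I_n.+1) : 'Hom(NDelta m, NDelta n) :=
  lext (fun F : face m => simplex (phi @: val F)).

(* The increasing enumeration of the vertices of F. *)
Definition face_incl (n : nat) (F : face n) (j : 'I_(#|val F|.-1).+1) : 'I_n.+1 :=
  nth ord0 (enum (val F)) j.

Definition steenrod (i n : nat) : 'Hom(NDelta n, chain (face n * face n)%type) :=
  lext (fun F : face n =>
    tens_hom (push (@face_incl n F)) (push (@face_incl n F))
      (steenrod_top i #|val F|.-1)).

(* steenrodP shows that steenrod i is the unique family with these two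
   properties; lift k is the k-th coface map. *)
Definition is_steenrod (i : nat)
    (D : forall n, 'Hom(NDelta n, chain (face n * face n)%type)) : Prop :=
  (forall n, D n (simplex setT) = steenrod_top i n) /\
  (forall n (k : 'I_n.+2),
     (D n.+1 \o push (lift k))%VF =
     (tens_hom (push (lift k)) (push (lift k)) \o D n)%VF).

Definition increasing (m n : nat) (phi : 'I_m -> 'I_n) : Prop :=
  forall j k : 'I_m, (j < k)%N -> (phi j < phi k)%N.

Lemma increasing_inj m n (phi : 'I_m -> 'I_n) : increasing phi -> injective phi.
Proof.
move=> ip j k e; apply: val_inj => /=.
by case: (ltngtP j k) => // /ip; rewrite e ltnn.
Qed.

Lemma increasing_uniq m n (phi psi : 'I_m -> 'I_n) :
    increasing phi -> increasing psi -> phi @: setT = psi @: setT ->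
  phi =1 psi.
Proof.
move=> iphi ipsi e j.
have srt (f : 'I_m -> 'I_n) : increasing f ->
    sorted (fun a b : 'I_n => (a < b)%N) [seq f k | k <- enum 'I_m].
  move=> incf; rewrite sorted_map.
  have := iota_ltn_sorted 0 m; rewrite -val_enum_ord sorted_map.
  by apply: sub_sorted => a b; apply: incf.
have : [seq phi k | k <- enum 'I_m] = [seq psi k | k <- enum 'I_m].
  apply: (irr_sorted_eq (leT := fun a b : 'I_n => (a < b)%N)) (srt _ iphi) (srt _ ipsi) _.
  - by move=> a b c; apply: ltn_trans.
  - by move=> a; apply: ltnn.
  move=> y; have mem (f : 'I_m -> 'I_n) : (y \in [seq f k | k <- enum 'I_m]) = (y \in f @: setT).
    apply/mapP/imsetP => [[k _ ->]|[k _ ->]]; exists k => //.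
    by rewrite mem_enum.
  by rewrite !mem e.
by move/eq_in_map => /(_ j); apply; rewrite mem_enum.
Qed.

Lemma simplex_val n (F : face n) : simplex (val F) = delta F.
Proof. by rewrite /simplex valK. Qed.

Lemma eq_push m n (phi psi : 'I_m.+1 -> 'I_n.+1) :
  phi =1 psi -> push phi = push psi.
Proof.
by move=> e; apply: hom_ext => F; rewrite !lextE (eq_imset _ e).
Qed.

Lemma push_simplex m n (phi : 'I_m.+1 -> 'I_n.+1) (F : {set 'I_m.+1}) :
  push phi (simplex F) = simplex (phi @: F).
Proof.
rewrite {1}/simplex; case: insubP => [G _ <-|]; first by rewrite lextE.
by rewrite negbK => /eqP->; rewrite imset0 linear0 /simplex insubF ?eqxx.
Qed.

Lemma push_comp l m n (psi : 'I_l.+1 -> 'I_m.+1) (phi : 'I_m.+1 -> 'I_n.+1) :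
  (push phi \o push psi)%VF = push (phi \o psi).
Proof.
by apply: hom_ext => F; rewrite comp_lfunE !lextE push_simplex -imset_comp.
Qed.

Lemma push_id n : push (@id 'I_n.+1) = \1%VF.
Proof. by apply: hom_ext => F; rewrite lextE imset_id simplex_val id_lfunE. Qed.

Lemma hom_sum (A B : finType) (f : 'Hom(chain A, chain B)) (u : chain A) b :
  (f u : {ffun B -> ('F_2)^o}) b =
  \sum_a (u : {ffun A -> ('F_2)^o}) a * (f (delta a) : {ffun B -> ('F_2)^o}) b.
Proof.
rewrite {1}(chain_sum u) linear_sum sum_ffunE.
by apply: eq_bigr => a _; rewrite linearZZ ffunE.
Qed.

Lemma tens_hom_tens (A B C D : finType)
    (f : 'Hom(chain A, chain C)) (g : 'Hom(chain B, chain D)) u v :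
  tens_hom f g (tens u v) = tens (f u) (g v).
Proof.
apply/ffunP => -[c d]; rewrite hom_sum ffunE /= !hom_sum big_distrlr /=.
rewrite pair_bigA /=; apply: eq_bigr => -[a b] _; rewrite lextE !ffunE /=.
by rewrite mulrACA.
Qed.

Lemma delta_pair (A B : finType) (ab : A * B) :
  delta ab = tens (delta ab.1) (delta ab.2).
Proof.
by apply/ffunP => -[c d]; case: ab => a b; rewrite !ffunE xpair_eqE -mulnb natrM.
Qed.

Lemma tens_hom_comp (A B C A' B' C' : finType)
    (f : 'Hom(chain B, chain C)) (g : 'Hom(chain A, chain B))
    (f' : 'Hom(chain B', chain C')) (g' : 'Hom(chain A', chain B')) :
  (tens_hom f f' \o tens_hom g g')%VF = tens_hom (f \o g)%VF (f' \o g')%VF.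
Proof.
apply: hom_ext => ab.
by rewrite comp_lfunE delta_pair !tens_hom_tens !comp_lfunE.
Qed.

Lemma tens_hom1 (A B : finType) : tens_hom (\1 : 'Hom(chain A, chain A))
  (\1 : 'Hom(chain B, chain B)) = \1%VF.
Proof. by apply: hom_ext => ab; rewrite lextE !id_lfunE -delta_pair. Qed.

Lemma card_face n (F : face n) : #|val F|.-1.+1 = #|val F|.
Proof. by rewrite prednK // card_gt0 (valP F). Qed.

Lemma face_incl_increasing n (F : face n) : increasing (@face_incl n F).
Proof.
move=> j k jk; rewrite /face_incl.
have kF : (k < size (enum (val F)))%N by rewrite -cardE; move: (ltn_ord k); rewrite {2}card_face.
have jF := ltn_trans jk kF.
have srt : sorted (fun a b : 'I_n.+1 => (a < b)%N) (enum (val F)).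
  rewrite {1}/enum_mem; apply: sorted_filter.
    by move=> a b c; apply: ltn_trans.
  by have := iota_ltn_sorted 0 n.+1; rewrite -val_enum_ord sorted_map enumT.
by apply: (sorted_ltn_nth _ _ srt) => // a b c; apply: ltn_trans.
Qed.

Lemma face_incl_im n (F : face n) : @face_incl n F @: setT = val F.
Proof.
apply/setP => x; apply/imsetP/idP => [[j _ ->]|xF].
  by rewrite /face_incl -(mem_enum (val F)) mem_nth // -cardE; move: (ltn_ord j); rewrite {2}card_face.
have xi : (index x (enum (val F)) < #|val F|.-1.+1)%N.
  by rewrite card_face cardE index_mem mem_enum.
by exists (Ordinal xi) => //; rewrite /face_incl /= nth_index // mem_enum.
Qed.

Lemma steenrodE i m n (phi : 'I_m.+1 -> 'I_n.+1) : increasing phi ->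
  steenrod i n (simplex (phi @: setT)) =
  tens_hom (push phi) (push phi) (steenrod_top i m).
Proof.
move=> iphi; have F0 : phi @: setT != set0.
  by apply/set0Pn; exists (phi ord0); apply: imset_f.
have [F FE] : exists F : face n, val F = phi @: setT.
  by exists (exist (fun A : {set _} => is_true (A != set0)) _ F0).
rewrite -FE simplex_val lextE.
have em : #|val F|.-1 = m.
  by rewrite FE card_imset ?cardsT ?card_ord //; apply: increasing_inj.
have := face_incl_increasing (F := F); have := face_incl_im F.
move: (@face_incl n F); rewrite em => psi ipsi incpsi; rewrite FE in ipsi.
by rewrite (eq_push (increasing_uniq incpsi iphi ipsi)).
Qed.

Lemma lift_increasing n (k : 'I_n.+1) : increasing (lift k : 'I_n -> 'I_n.+1).
Proof. by move=> a b ab /=; rewrite /bump; lia. Qed.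

Lemma increasing_split m n (phi : 'I_m.+1 -> 'I_n.+2) k : increasing phi ->
    (forall j, k != phi j) ->
  exists2 psi : 'I_m.+1 -> 'I_n.+1, increasing psi & phi =1 lift k \o psi.
Proof.
move=> iphi kphi.
pose psi j := odflt ord0 (unlift k (phi j)).
have psiE j : phi j = lift k (psi j).
  by rewrite /psi; case: unliftP (kphi j) => [l -> //|->]; rewrite eqxx.
exists psi => // a b ab; have := iphi a b ab; rewrite !psiE /=.
by rewrite /bump; lia.
Qed.

Lemma steenrodP (i : nat) (D : forall n, 'Hom(NDelta n, chain (face n * face n)%type)) :
  is_steenrod i D <-> forall n, D n = steenrod i n.
Proof.
split=> [[Dtop Dnat] n|DE].
  have main m (phi : 'I_m.+1 -> 'I_n.+1) : increasing phi ->
      (D n \o push phi = tens_hom (push phi) (push phi) \o D m)%VF.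
    elim: n => [|n IHn] in phi *; move=> iphi.
      have m0 : m = 0%N.
        have := leq_card _ (increasing_inj iphi); rewrite !card_ord; lia.
      subst m; have /eq_push -> : phi =1 id by move=> j; rewrite !ord1.
      by rewrite push_id tens_hom1 comp_lfun1r comp_lfun1l.
    have [/forallP ex|] := boolP [forall k, k \in phi @: setT].
      have im : phi @: setT = setT by apply/setP => k; rewrite ex inE.
      have em : m = n.+1.
        have := card_imset setT (increasing_inj iphi).
        by rewrite im !cardsT !card_ord => -[].
      subst m; have /eq_push -> : phi =1 id.
        by apply: increasing_uniq; rewrite // im imset_id.
      by rewrite push_id tens_hom1 comp_lfun1r comp_lfun1l.
    rewrite negb_forall => /existsP[k kphi].
    have [|psi ipsi /eq_push ->] := increasing_split (k := k) iphi.
      by move=> j; apply: contra kphi => /eqP->; apply: imset_f.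
    by rewrite -push_comp comp_lfunA Dnat -comp_lfunA IHn // comp_lfunA tens_hom_comp.
  apply: hom_ext => F; have iF := face_incl_increasing (F := F).
  rewrite -simplex_val -face_incl_im steenrodE // -push_simplex.
  by rewrite -comp_lfunE main // comp_lfunE Dtop.
split=> [n|n k]; rewrite !DE.
  have := @steenrodE i n n id (fun _ _ => id).
  by rewrite imset_id push_id tens_hom1 id_lfunE.
apply: hom_ext => F; have iF := face_incl_increasing (F := F).
rewrite !comp_lfunE -simplex_val push_simplex -face_incl_im steenrodE //.
rewrite -imset_comp steenrodE; first by rewrite -push_comp -tens_hom_comp comp_lfunE.
by move=> a b ab; apply/lift_increasing/iF.
Qed.

(* Main.v *)
(** Iterating the Alexander-Whitney diagonal on a face F gives a sum over weakly
    increasing sequences p_1 <= ... <= p_{i+1} of vertices of F, and grouping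
    along (1,2,1,2,...) joins the even pieces on the left and the odd ones on
    the right.  If p_{k+1} = p_{k+2}, the k-th and (k+2)-nd pieces share this
    vertex and lie in the same factor, so that their join vanishes.  The
    surviving strictly increasing sequences are those of Steenrod's formula. *)

Require Import Defs.
From mathcomp Require Import all_boot all_order all_algebra.
From mathcomp Require Import zify.
Set Implicit Arguments.
Unset Strict Implicit.
Unset Printing Implicit Defensive.
Import GRing.Theory.
Local Open Scope ring_scope.

(** * Tensors of chains, and joins of simplices *)

Lemma tens_suml (A B I : finType) (P : pred I) (u : I -> chain A) (v : chain B) :
  tens (\sum_(i | P i) u i) v = \sum_(i | P i) tens (u i) v.
Proof.
apply/ffunP => ab; rewrite ffunE !sum_ffunE mulr_suml.
by apply: eq_bigr => i _; rewrite ffunE.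
Qed.

Lemma tens0l (A B : finType) (v : chain B) : tens (0 : chain A) v = 0.
Proof. by apply/ffunP => ab; rewrite !ffunE mul0r. Qed.

Lemma tens0r (A B : finType) (u : chain A) : tens u (0 : chain B) = 0.
Proof. by apply/ffunP => ab; rewrite !ffunE mulr0. Qed.

Lemma tens_delta (A B : finType) (a : A) (b : B) :
  tens (delta a) (delta b) = delta (a, b).
Proof. by rewrite (delta_pair (a, b)). Qed.

Lemma simplex0 n : simplex (set0 : {set 'I_n.+1}) = 0.
Proof. by rewrite /simplex insubF ?eqxx. Qed.

(** [F0] is the value on the empty set. A basis element, unlike the chain [simplex S], can be an
    entry of a tuple. *)
Definition face_of n (F0 : face n) (S : {set 'I_n.+1}) : face n := insubd F0 S.

Lemma val_face_of n (F0 : face n) (S : {set 'I_n.+1}) :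
  S != set0 -> val (face_of F0 S) = S.
Proof. by move=> S0; rewrite insubdK. Qed.

Lemma simplex_face_of n (F0 : face n) (S : {set 'I_n.+1}) :
  S != set0 -> simplex S = delta (face_of F0 S).
Proof. by move=> S0; rewrite -simplex_val val_face_of. Qed.

Lemma join_simplex n (S T : {set 'I_n.+1}) : S != set0 -> T != set0 ->
  join n (tens (simplex S) (simplex T)) =
  if [disjoint S & T] then simplex (S :|: T) else 0.
Proof.
move=> S0 T0; pose F : face n := exist (fun U : {set _} => is_true (U != set0)) _ S0.
rewrite (simplex_face_of F S0) (simplex_face_of F T0) tens_delta.
by rewrite lextE /= !val_face_of.
Qed.

Lemma joins_rcons n (u : NDelta n) us v :
  joins (rcons (u :: us) v) = join n (tens (joins (u :: us)) v).
Proof. by rewrite /= foldl_rcons. Qed.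

Lemma foldl_join0 n (us : seq (NDelta n)) :
  foldl (fun x y => join n (tens x y)) 0 us = 0.
Proof. by elim: us => //= u us IH; rewrite tens0l linear0. Qed.

(** An empty set spans the chain 0, which falls under the first alternative; inductions on joins
    thus avoid nonemptiness conditions. *)
Lemma join_simplex_incl n (S T : {set 'I_n.+1}) :
  join n (tens (simplex S) (simplex T)) = 0 \/
  [disjoint S & T] /\
  join n (tens (simplex S) (simplex T)) = simplex (S :|: T).
Proof.
have [->|S0] := eqVneq S set0; first by left; rewrite simplex0 tens0l linear0.
have [->|T0] := eqVneq T set0; first by left; rewrite simplex0 tens0r linear0.
by rewrite join_simplex //; case: ifP; [right | left].
Qed.

(** The left fold replaces the first two sets by their union. If they meet, the join is 0 from then
    on; otherwise any overlap with a later set survives in the union. *)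
Lemma joins_overlap n (Ss : seq {set 'I_n.+1}) :
  ~~ pairwise (fun S T : {set 'I_n.+1} => [disjoint S & T]) Ss ->
  joins [seq simplex S0 | S0 <- Ss] = 0.
Proof.
case: Ss => //= S1 Ss; elim: Ss S1 => [//|T Ss IH] S1 /=.
have [->|[dST ->] H] := join_simplex_incl S1 T; first by rewrite foldl_join0.
apply: IH; apply: contra H => /andP[aU ->]; rewrite dST andbT /=.
apply/andP; split; apply: sub_all aU => U; apply: disjointWl.
  exact: subsetUl.
exact: subsetUr.
Qed.

(** Injectivity keeps disjoint vertex sets disjoint, so that a nonzero join is not sent to a
    vanishing one. *)
Lemma push_join m n (phi : 'I_m.+1 -> 'I_n.+1) (u v : NDelta m) :
  injective phi ->
  push phi (join m (tens u v)) = join n (tens (push phi u) (push phi v)).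
Proof.
move=> phiI; rewrite -tens_hom_tens -!comp_lfunE.
(* Both sides are linear maps applied to [tens u v], so it suffices to compare them on pairs of
   faces. *)
congr (fun_of_lfun _ _); apply: hom_ext => -[F G]; rewrite !comp_lfunE.
have imN0 (H : face m) : phi @: val H != set0.
  by rewrite imset_eq0; exact: (valP H).
rewrite -tens_delta tens_hom_tens -!simplex_val !push_simplex.
rewrite !join_simplex ?(valP F) ?(valP G) ?imN0 //.
by rewrite imset_disjoint //; case: ifP => _; rewrite ?push_simplex ?imsetU ?linear0.
Qed.

Lemma push_joins m n (phi : 'I_m.+1 -> 'I_n.+1) (us : seq (NDelta m)) :
  injective phi -> push phi (joins us) = joins [seq push phi u | u <- us].
Proof.
move=> phiI; case: us => [|u us] /=; first by rewrite linear0.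
by elim: us u => //= v us IH u; rewrite IH push_join.
Qed.

(** * Iterated joins of basis tensors *)

Lemma rcons_pairK (T : Type) m : cancel (@rcons_pair T m) (@unrcons T m).
Proof.
case=> t x; rewrite /unrcons; congr (_, _).
  apply: val_inj => /=; rewrite /thead (tnth_nth x) /=.
  by case: t => -[|y t] _ //=; rewrite belast_rcons.
rewrite (tnth_nth x) /= nth_rcons size_tuple ltnn eqxx //.
Qed.

Lemma unrconsK (T : Type) m : cancel (@unrcons T m) (@rcons_pair T m).
Proof.
move=> t; apply: val_inj => /=; rewrite (tnth_nth (thead t)) /=.
case/tupleP: t => y t; rewrite theadE /=.
by rewrite [RHS]lastI (last_nth y) size_tuple.
Qed.

(** Both iterations bracket to the left, so the induction splits off the last entry. In exponent 0
    both sides are the default 0. *)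
Lemma join_iterE n m (t : m.-tuple (face n)) :
  join_iter n m (delta t) = joins [seq delta F | F <- t].
Proof.
case: m t => [|m] t; first by rewrite zero_lfunE tuple0.
elim: m t => [|m IH] t /=.
  by rewrite lextE; case/tupleP: t => F t; rewrite (tuple0 t) theadE.
rewrite !comp_lfunE lextE -{2}(unrconsK t); case: (unrcons t) => t' F.
rewrite lextE IH id_lfunE /= map_rcons.
by case/tupleP: t' => G t'; rewrite joins_rcons.
Qed.


(** * Cutting a face at a sequence of its vertices *)

(* breakpoint p k is p_k, with p_0 = 0 and p_k = n for k = size p + 1; hence the
   indexing of breakpoint is shifted by one from that of the sequence p. *)
Definition breakpoint n (p : seq 'I_n.+1) : nat -> nat :=
  nth 0%N (0%N :: rcons [seq val x | x <- p] n).

(** Intersecting with [F] allows the outer bounds 0 and [n] in place of the extreme vertices of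
    [F]. *)
Definition cell n (F : {set 'I_n.+1}) (p : seq 'I_n.+1) k : {set 'I_n.+1} :=
  [set x in F | (breakpoint p k <= x <= breakpoint p k.+1)%N].

(** Repetitions are allowed, since the iterated diagonal may cut several times at one vertex. *)
Definition cutting n (F : {set 'I_n.+1}) : pred (seq 'I_n.+1) :=
  fun p => sorted leq [seq val x | x <- p] && all [in F] p.

Lemma breakpointS n (p : seq 'I_n.+1) k : (k < size p)%N ->
  breakpoint p k.+1 = nth ord0 p k.
Proof.
by move=> kp; rewrite /breakpoint /= nth_rcons size_map kp (nth_map ord0).
Qed.

Lemma breakpoint_last n (p : seq 'I_n.+1) : breakpoint p (size p).+1 = n.
Proof. by rewrite /breakpoint /= nth_rcons size_map ltnn eqxx. Qed.

Lemma breakpoint_rcons n (p : seq 'I_n.+1) v k : (k <= size p)%N ->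
  breakpoint (rcons p v) k = breakpoint p k.
Proof.
case: k => // k kp; rewrite !breakpointS ?size_rcons ?ltnS ?(ltnW kp) //.
by rewrite nth_rcons kp.
Qed.

Lemma breakpoint_homo n (p : seq 'I_n.+1) k : sorted leq [seq val x | x <- p] ->
  (k <= size p)%N -> (breakpoint p k <= breakpoint p k.+1)%N.
Proof.
move=> srt; case: k => // k kp; rewrite breakpointS //.
have [->|kp'] := eqVneq k.+1 (size p); first by rewrite breakpoint_last -ltnS.
have {}kp' : (k.+1 < size p)%N by rewrite ltn_neqAle kp'.
rewrite breakpointS //; move/(sortedP 0%N): srt => /(_ k).
by rewrite size_map !(nth_map ord0) //; apply.
Qed.

(** A cell before the last contains its upper breakpoint, the last one its lower breakpoint; with no
    breakpoints the only cell is [F]. *)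
Lemma cell_neq0 n (F : {set 'I_n.+1}) p k :
  F != set0 -> cutting F p -> (k <= size p)%N -> cell F p k != set0.
Proof.
move=> /set0Pn[x xF] /andP[srt /allP pF] kp; have := breakpoint_homo srt kp.
move=> homo; apply/set0Pn; move: kp; rewrite leq_eqVlt => /predU1P[kp|kp]; last first.
  exists (nth ord0 p k); rewrite inE pF ?mem_nth //= -breakpointS //.
  by rewrite homo leqnn.
case: k kp homo => [|k] kp homo.
  exists x; rewrite inE xF (_ : 1 = (size p).+1)%N; last by rewrite -kp.
  by rewrite breakpoint_last leq_ord.
have kp' : (k < size p)%N by rewrite -kp.
exists (nth ord0 p k); rewrite inE pF ?mem_nth //= -breakpointS //.
by rewrite leqnn.
Qed.

(** For [k = size p], appending [v] lowers the upper bound from [n] to [v], just as truncating [F]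
    at [v] does. Earlier cells already end at a breakpoint at most [v]. *)
Lemma cell_rcons n (F : {set 'I_n.+1}) p (v : 'I_n.+1) k :
  all (fun x : 'I_n.+1 => (x <= v)%N) p -> (k <= size p)%N ->
  cell F (rcons p v) k = cell [set x in F | (x <= v)%N] p k.
Proof.
move=> /allP pv kp; apply/setP => x; rewrite !inE breakpoint_rcons //.
rewrite -andbA; congr (_ && _); have xn := leq_ord x.
move: kp; rewrite leq_eqVlt => /predU1P[->|kp].
  rewrite breakpointS ?size_rcons // nth_rcons ltnn eqxx breakpoint_last xn.
  by rewrite andbT andbC.
rewrite breakpoint_rcons // breakpointS //.
have := pv _ (mem_nth ord0 kp); case: (boolP (x <= nth ord0 p k)%N) => [xp pkv|].
  by rewrite (leq_trans xp pkv).
by rewrite !andbF.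
Qed.

Lemma cell_rcons_last n (F : {set 'I_n.+1}) p (v : 'I_n.+1) :
  cell F (rcons p v) (size p).+1 = [set x in F | (v <= x)%N].
Proof.
have := breakpoint_last (rcons p v); rewrite size_rcons => bl.
apply/setP => x; rewrite !inE bl breakpointS ?size_rcons // nth_rcons ltnn eqxx.
by rewrite leq_ord andbT.
Qed.

(** This mirrors the recursion of the diagonal: the last breakpoint [v] is cut first, and the others
    then cut the front face ending at [v]. *)
Lemma cutting_rcons n (F : {set 'I_n.+1}) p (v : 'I_n.+1) :
  cutting F (rcons p v) = (v \in F) && cutting [set x in F | (x <= v)%N] p.
Proof.
rewrite /cutting map_rcons !(sorted_pairwise leq_trans) pairwise_rcons all_rcons.
have -> : all [in [set x in F | (x <= v)%N]] p =
    all [in F] p && all (fun x : 'I_n.+1 => (x <= v)%N) p.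
  by rewrite -all_predI; apply: eq_all => x; rewrite /= inE.
rewrite all_map /=; case: (v \in F) => /=; last by rewrite andbF.
by case: (pairwise _ _); rewrite ?andbF //= andbT andbC.
Qed.

(** * The iterated Alexander-Whitney diagonal *)

Lemma val_mktuple_nat (T : Type) m (G : nat -> T) :
  tval [tuple G (val k) | k < m] = [seq G k | k <- iota 0 m].
Proof. by rewrite /= (map_comp G val) val_enum_ord. Qed.

Lemma AW_iterSE n m (F : face n) :
  AW_iterS n m (delta F) =
  \sum_(p : m.-tuple 'I_n.+1 | cutting (val F) p)
     delta [tuple face_of F (cell (val F) p (val k)) | k < m.+1].
Proof.
elim: m F => [|m IH] F.
  rewrite lextE (big_pred1 [tuple]) => [|p]; last first.
    by rewrite tuple0; apply/esym/eqP/val_inj.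
  congr delta; apply: eq_from_tnth => k; rewrite tnth_mktuple ord1.
  rewrite (_ : cell _ _ _ = val F) /face_of ?valKd //.
  by apply/setP => x; rewrite inE /breakpoint /= -ltnS ltn_ord andbT.
rewrite /= !comp_lfunE lextE !linear_sum.
(* The last breakpoint [v] is placed first in the pair because the condition on the remaining
   sequence depends on it. *)
rewrite [RHS](reindex (fun vp => rcons_pair (vp.2, vp.1))) /=; last first.
  exists (fun t => let u := unrcons t in (u.2, u.1)) => [[v p]|t] _.
    by rewrite -[LHS]/(let u := unrcons (rcons_pair (p, v)) in (u.2, u.1)) rcons_pairK.
  by rewrite -[RHS]unrconsK; case: (unrcons t).
under [RHS]eq_bigl do rewrite cutting_rcons.
rewrite -(pair_big_dep _ (fun (v : 'I_n.+1) (p : m.-tuple 'I_n.+1) =>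
    cutting [set x in val F | (x <= v)%N] p)
  (fun (v : 'I_n.+1) (p : m.-tuple 'I_n.+1) =>
    delta [tuple face_of F (cell (val F) (rcons p v) (val k)) | k < m.+2])) /=.
apply: eq_bigr => v vF.
have lN0 : [set x in val F | (x <= v)%N] != set0.
  by apply/set0Pn; exists v; rewrite inE vF /=.
have rN0 : [set x in val F | (v <= x)%N] != set0.
  by apply/set0Pn; exists v; rewrite inE vF /=.
rewrite (simplex_face_of F lN0) (simplex_face_of F rN0) tens_hom_tens IH.
rewrite id_lfunE val_face_of // tens_suml linear_sum; apply: eq_bigr => p cp.
rewrite tens_delta [LHS]lextE; congr delta; apply: val_inj.
have sp : size p = m by rewrite size_tuple.
rewrite [RHS](val_mktuple_nat _ (fun k => face_of F (cell (val F) (rcons p v) k))).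
rewrite /rcons_pair [LHS]/= -[m.+2]addn1 iotaD add0n cats1 map_rcons.
congr (rcons _ _); last by rewrite -{2}sp cell_rcons_last.
rewrite -[LHS]/(tval [tuple face_of (face_of F [set x in val F | (x <= v)%N])
   (cell [set x in val F | (x <= v)%N] p (val k)) | k < m.+1]).
rewrite (val_mktuple_nat _ (fun k => face_of (face_of F _) (cell _ p k))).
apply/eq_in_map => k; rewrite mem_iota /= add0n ltnS => kp; rewrite -{1}sp in kp.
have pv : all (fun x : 'I_n.+1 => (x <= v)%N) p.
  by case/andP: cp => _; apply: sub_all => x; rewrite !inE => /andP[].
(* The two sides carry different default faces, so they are compared through their nonempty vertex
   sets. *)
have cN0 := cell_neq0 lN0 cp kp.
by rewrite cell_rcons //; apply: val_inj; rewrite !val_face_of.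
Qed.

(** * The action of the alternating surjection *)

(** Only the tuple [[tuple a; b]] contributes to the coefficient at [(a, b)]. *)
Lemma bigtens2 (A : 'I_2 -> finType) (B : finType)
    (f : forall k, 'Hom(chain (A k), chain B)) (x : {dffun forall k, A k}) :
  bmap (fun t : 2.-tuple B => (tnth t ord0, tnth t ord_max))
    (bigtens_hom f (delta x)) =
  tens (f ord0 (delta (x ord0))) (f ord_max (delta (x ord_max))).
Proof.
apply/ffunP => -[a b]; rewrite hom_sum (bigD1 [tuple a; b]) //= big1 => [|t].
  have l01 : lift ord0 ord0 = ord_max :> 'I_2 by apply: val_inj.
  rewrite !lextE !ffunE.
  have -> : (a, b) == (tnth [tuple a; b] ord0, tnth [tuple a; b] ord_max) by exact/eqP.
  by rewrite mulr1 addr0 big_ord_recl big_ord1 l01.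
move=> tab; rewrite !lextE [X in _ * X]ffunE.
have /negPf -> : (a, b) != (tnth t ord0, tnth t ord_max); last by rewrite mulr0.
apply: contraNneq tab => -[-> ->]; apply/eqP/eq_from_tnth => k.
by have [->|->] : k = ord0 \/ k = ord_max
  by case: k => -[|[|]] // lt; [left | right]; apply: val_inj.
Qed.

(** This turns the increasing enumeration of a fiber into the parity filter of Steenrod's
    formula. *)
Lemma map_fiber_alternating i (T : Type) (G : nat -> T) (k : 'I_2) :
  [seq G (val j) | j <- enum (fiber (alternating i) k)] =
  [seq G j | j <- iota 0 i.+2 & odd j == (k == ord_max)].
Proof.
rewrite -val_enum_ord filter_map -map_comp; congr map.
rewrite {1}/enum_mem -enumT; apply: eq_filter => j; rewrite /= inE tnth_mktuple.
by case: (odd j); case: k => -[|[|]].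
Qed.

Lemma map_enum_val (T : finType) (x0 : T) (A : {set T}) :
  [seq enum_val j | j <- enum 'I_#|A|] = enum A.
Proof.
rewrite (eq_map (enum_val_nth x0)) (map_comp (nth x0 (enum A)) val).
by rewrite val_enum_ord cardE map_nth_iota0 // take_size.
Qed.

(** The common summand of both constructions: weakly increasing [p] index the action, strictly
    increasing ones Steenrod's formula. *)
Definition alt_term i n (F : {set 'I_n.+1}) (p : seq 'I_n.+1) :=
  tens (joins [seq simplex (cell F p k) | k <- iota 0 i.+2 & ~~ odd k])
       (joins [seq simplex (cell F p k) | k <- iota 0 i.+2 & odd k]).

Lemma alt_actE i n (F : face n) :
  alt_act i n (delta F) =
  \sum_(p : i.+1.-tuple 'I_n.+1 | cutting (val F) p) alt_term i (val F) p.
Proof.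
rewrite /alt_act /surj_act 3!comp_lfunE.
rewrite -[AW_iter n i.+2]/(AW_iterS n i.+1) AW_iterSE !linear_sum.
apply: eq_bigr => p cp; set t := [tuple _ | _ < _].
rewrite -[LHS]/(bmap _ (bigtens_hom _ (fiber_perm n (alternating i) (delta t)))).
rewrite lextE bigtens2 !join_iterE !ffunE.
have E (k : 'I_2) :
    [seq delta G | G <- [tuple tnth t (enum_val j) | j < #|fiber (alternating i) k|]] =
    [seq simplex (cell (val F) p j) | j <- iota 0 i.+2 & odd j == (k == ord_max)].
  rewrite -(map_fiber_alternating i (fun j => simplex (cell (val F) p j))).
  rewrite -map_comp /= [in RHS](_ : enum _ =
      [seq enum_val j | j <- enum 'I_#|fiber (alternating i) k|]).
    rewrite -[RHS]map_comp; apply: eq_map => j /=.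
    rewrite tnth_mktuple -simplex_face_of //.
    apply: cell_neq0 => //; first exact: (valP F).
    by rewrite size_tuple leq_ord.
  by rewrite (map_enum_val ord0).
rewrite !E /alt_term; congr (tens (joins _) (joins _)); congr map.
  by apply: eq_filter => j; case: (odd j).
by apply: eq_filter => j; case: (odd j).
Qed.

(** * Vanishing of the summands with a repeated breakpoint *)

Lemma alt_term_repeat i n (F : {set 'I_n.+1}) (p : i.+1.-tuple 'I_n.+1) :
  cutting F p -> ~~ sorted ltn [seq val x | x <- p] -> alt_term i F p = 0.
Proof.
case/andP=> srt /allP pF nsrt.
(* Entry [j] of [p] is breakpoint [j.+1], the upper end of cell [j]; entry [j.+1] is the lower end
   of cell [j.+2]. *)
have [j ji pj] : exists2 j, (j.+1 < i.+1)%N & nth ord0 p j = nth ord0 p j.+1.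
  have [/existsP[j /eqP pj]|] := boolP [exists j : 'I_i,
      nth ord0 p j == nth ord0 p j.+1].
    by exists j => //; exact: ltn_ord.
  rewrite negb_exists => /forallP pN; case/negP: nsrt.
  apply/(sortedP 0%N) => j; rewrite size_map size_tuple ltnS => ji.
  have ji' := ltnW ji; have := pN (Ordinal ji); move/(sortedP 0%N)/(_ j): srt.
  rewrite size_map size_tuple ltnS => /(_ ji); rewrite !(nth_map ord0) ?size_tuple //.
  by move=> le_j ne_j; rewrite /= ltn_neqAle le_j andbT.
have sp : size p = i.+1 by rewrite size_tuple.
have overlap (a : pred nat) : a j -> a j.+2 ->
    joins [seq simplex (cell F p k) | k <- iota 0 i.+2 & a k] = 0.
  move=> aj aj2; rewrite (map_comp (@simplex n) (cell F p)); apply: joins_overlap.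
  have jsub : subseq [:: j; j.+2] [seq k <- iota 0 i.+2 | a k].
    rewrite subseq_filter; apply/andP; split; first by rewrite /= aj aj2.
    (* Since [j < i], the indices [j], [j.+1] and [j.+2] all occur in [iota 0 i.+2], right after its
       first [j] terms. *)
    have -> : (i.+2 = j + (3 + (i.+2 - j - 3)))%N by lia.
    rewrite iotaD -[X in subseq X _]cat0s; apply: cat_subseq; first exact: sub0seq.
    by rewrite add0n /= !eqxx gtn_eqF // eqxx sub0seq.
  apply/negP => /(subseq_pairwise (map_subseq _ jsub)) /=.
  rewrite !andbT => /pred0P/(_ (nth ord0 p j)) /=.
  have pjF : nth ord0 p j \in F by apply: pF; rewrite mem_nth // sp ltnW.
  rewrite !inE pjF /= breakpointS ?sp ?(ltnW ji) // leqnn andbT.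
  rewrite breakpointS ?sp // -pj leqnn /=.
  have := breakpoint_homo srt (k := j); rewrite breakpointS ?sp ?(ltnW ji) //.
  rewrite ltnW ?(ltnW ji) // => -> //.
  by have := breakpoint_homo srt (k := j.+2); rewrite breakpointS ?sp // -pj => ->.
(* The parity of [j] decides which tensor factor contains the two overlapping cells. *)
rewrite /alt_term; case: (boolP (odd j)) => oj.
  by rewrite [X in tens _ X]overlap ?tens0r //= negbK.
by rewrite [X in tens X _]overlap ?tens0l //= negbK.
Qed.

(** * Steenrod's formula on an arbitrary face *)

Lemma increasing_leq m n (phi : 'I_m.+1 -> 'I_n.+1) : increasing phi ->
  forall a b : 'I_m.+1, (phi a <= phi b)%N = (a <= b)%N.
Proof.
move=> iphi a b; case: (ltngtP a b) => [/iphi/ltnW//|/iphi|/val_inj->];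
  last exact: leqnn.
by rewrite ltnNge => /negPf.
Qed.

(** Inner breakpoints are transported by the order embedding. The outer bounds 0 and [m] become 0
    and [n] instead of their images under [phi], but hold automatically on both sides. *)
Lemma imset_cell m n (phi : 'I_m.+1 -> 'I_n.+1) p k :
  increasing phi -> (k <= size p)%N ->
  phi @: cell setT p k = cell (phi @: setT) [seq phi x | x <- p] k.
Proof.
move=> iphi kp.
have cellE y : (y \in cell setT p k) =
    (breakpoint [seq phi x | x <- p] k <= phi y <=
       breakpoint [seq phi x | x <- p] k.+1)%N.
  rewrite !inE andTb; congr (_ && _).
    case: k kp => // k kp; rewrite !breakpointS ?size_map // (nth_map ord0) //.
    by rewrite increasing_leq.
  move: kp; rewrite leq_eqVlt => /predU1P[->|kp].
    by rewrite -{2}(size_map phi) !breakpoint_last !leq_ord.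
  by rewrite !breakpointS ?size_map // (nth_map ord0) // increasing_leq.
apply/setP => x; rewrite [RHS]inE; apply/imsetP/andP => [[y yc ->]|[/imsetP[y _ ->]]].
  by rewrite imset_f // -cellE.
by rewrite -cellE; exists y.
Qed.

Lemma push_alt_term i m n (phi : 'I_m.+1 -> 'I_n.+1) (p : i.+1.-tuple 'I_m.+1) :
  increasing phi ->
  tens_hom (push phi) (push phi) (alt_term i setT p) =
  alt_term i (phi @: setT) [seq phi x | x <- p].
Proof.
move=> iphi; rewrite tens_hom_tens !push_joins; try exact: increasing_inj.
have E (a : pred nat) :
    [seq push phi u | u <- [seq simplex (cell setT p k) | k <- iota 0 i.+2 & a k]] =
    [seq simplex (cell (phi @: setT) [seq phi x | x <- p] k) | k <- iota 0 i.+2 & a k].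
  rewrite -map_comp; apply/eq_in_map => k.
  rewrite mem_filter mem_iota add0n /= ltnS => /andP[_ ki].
  by rewrite push_simplex imset_cell // size_tuple.
by rewrite !E.
Qed.

Lemma steenrod_topE i n :
  steenrod_top i n =
  \sum_(p : i.+1.-tuple 'I_n.+1 | sorted ltn [seq val x | x <- p])
     alt_term i setT p.
Proof.
have cellE (p : i.+1.-tuple 'I_n.+1) k :
    Defs.interval n (breakpoint p k) (breakpoint p k.+1) = simplex (cell setT p k).
  by congr simplex; apply/setP => x; rewrite !inE.
rewrite /steenrod_top; case: ltnP => [ni|_].
  (* For [n < i] the sum is empty: [i.+1] distinct entries do not fit among [n.+1] vertices. *)
  rewrite big_pred0 // => p; apply/negP => /(sorted_uniq ltn_trans ltnn).
  rewrite (map_inj_uniq val_inj) => /card_uniqP; rewrite size_tuple => cp.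
  by have := max_card (mem p); rewrite cp card_ord ltnS leqNgt ni.
by apply: eq_bigr => p _; congr (tens (joins _) (joins _));
  apply: eq_map => k; apply: cellE.
Qed.

Lemma steenrod_delta i n (F : face n) :
  steenrod i n (delta F) =
  \sum_(p : i.+1.-tuple 'I_n.+1 |
          sorted ltn [seq val x | x <- p] && all [in val F] p)
     alt_term i (val F) p.
Proof.
rewrite lextE; have := face_incl_increasing (F := F); have := face_incl_im F.
move: (@face_incl n F) => phi im_phi iphi.
(* [psi] inverts [phi] on the vertices of [F] and is [ord0] elsewhere; hence applying [phi]
   entrywise is a bijection onto the sequences of vertices of [F]. *)
pose psi x := odflt ord0 [pick y | phi y == x].
have phiK : cancel phi psi.
  move=> y; rewrite /psi; case: pickP => [z /eqP/(increasing_inj iphi) //|/(_ y)].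
  by rewrite eqxx.
have psiK : {in val F, cancel psi phi}.
  by move=> x; rewrite -im_phi => /imsetP[y _ ->]; rewrite phiK.
rewrite steenrod_topE linear_sum.
rewrite [RHS](reindex_onto (map_tuple phi) (map_tuple psi)) => [|p /andP[_ /allP pF]].
  apply: eq_big => [p|p _]; last by rewrite [LHS]push_alt_term ?im_phi.
  rewrite [X in _ && X](_ : _ = true) ?andbT; last first.
    by apply/eqP/val_inj; rewrite /= mapK.
  rewrite [X in _ && X](_ : _ = true) ?andbT; last first.
    by apply/allP => x /mapP[y _ ->]; rewrite /= -im_phi imset_f.
  rewrite /= !sorted_map; apply: eq_sorted => a b /=.
  by rewrite !ltnNge increasing_leq.
by apply: val_inj; rewrite /= -map_comp map_id_in // => x /pF; apply: psiK.
Qed.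

Theorem mainTheorem5 (i n : nat) : alt_act i n = steenrod i n.
Proof.
apply: hom_ext => F; rewrite alt_actE steenrod_delta.
(* The sum splits into strictly increasing sequences and those with a repetition. *)
rewrite (bigID (fun p : _.-tuple _ => sorted ltn [seq val x | x <- p])) /=.
rewrite [X in _ + X]big1 ?addr0 => [|p /andP[]]; last exact: alt_term_repeat.
apply: eq_bigl => p; rewrite andbC /cutting andbA; congr (_ && _).
by apply: andb_idr; apply: sub_sorted => a b; apply: ltnW.
Qed.
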